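(* Let $X$ be a Banach space and let $T\in L(X)$. Then the following statements are equivalent: (i) $T$ is EP; (ii) there exist Banach spaces $X_1$ and $X_2$, an isomorphism $T_1\in L(X_1)$, an injective $S\in L(X_1\oplus_1X_2,X)$, a surjective $U\in L(X,X_1\oplus_1X_2)$, and a hermitian idempotent $P\in L(X)$ such that $T=S(T_1\oplus 0)U$, $R(P)=S(X_1\oplus 0)$ and $N(P)=U^{-1}(0\oplus X_2)$.
   Context: Banach spaces are complex; $L(X,Y)$ is the space of bounded linear maps $X\to Y$, $L(X)=L(X,X)$; $N(\cdot)$, $R(\cdot)$ denote null space and range, and $U^{-1}(\cdot)$ denotes preimage. $X_1\oplus_1X_2$ is the direct sum with norm $\|x_1\oplus x_2\|=\|x_1\|+\|x_2\|$, and $T_1\oplus 0$ is the map $x_1\oplus x_2\mapsto T_1x_1\oplus 0$. An isomorphism is a bijective bounded linear map. An operator $S\in L(X)$ is hermitian if $\|\exp(itS)\|=1$ for all $t\in\mathbb{R}$. The Moore-Penrose inverse of $T\in L(X)$, if it exists, is the (unique) $S\in L(X)$ with $T=TST$, $S=STS$ and $TS$, $ST$ hermitian; it is denoted $T^{\dag}$. $T$ is EP if $T^{\dag}$ exists and $TT^{\dag}=T^{\dag}T$. *)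

(* Defs.v *)
(* MathComp-Analysis; complex scalars are R[i] with R : realType. *)
From HB Require Import structures.
From mathcomp Require Import all_boot all_order all_algebra.
From mathcomp Require Import complex.
From mathcomp Require Import all_classical all_reals all_analysis.

Set Implicit Arguments.
Unset Strict Implicit.
Unset Printing Implicit Defensive.

Import Order.TTheory GRing.Theory Num.Theory.
Import numFieldNormedType.Exports.

Local Open Scope classical_set_scope.
Local Open Scope complex_scope.
Local Open Scope ring_scope.

Section BoundedLinearMaps.
Variables (R : realType) (X Y : normedModType R[i]).
Local Notation C := R[i].

Definition bounded_linear (f : X -> Y) : Prop :=
  linear f /\ exists M : C, forall x, `|f x| <= M * `|x|.

Definition bounded_linear_pred : {pred X -> Y} := fun f => `[< bounded_linear f >].

Lemma bounded_linearP f : (f \in bounded_linear_pred) <-> bounded_linear f.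
Proof. exact: (iff_sym (rwP (asboolP _))). Qed.

Lemma bounded_linear_pos (f : X -> Y) : bounded_linear f ->
  exists M : R, 0 <= M /\ forall x, `|f x| <= M%:C * `|x|.
Proof.
move=> [lf [M Mf]].
exists (complex.Re `|M|); split.
  by have := normr_ge0 M; rewrite lecE => /andP[].
move=> x; rewrite RRe_real ?normr_real//.
apply: le_trans (Mf x) _.
have [->|x0] := eqVneq x 0; first by rewrite normr0 !mulr0.
have nx : 0 < `|x| by rewrite normr_gt0.
rewrite ler_pM2r//; apply: real_ler_norm.
have : 0 <= M * `|x| by apply: le_trans (Mf x).
by rewrite pmulr_lge0// => /ger0_real.
Qed.

Lemma bounded_linear_submod_closed : submod_closed bounded_linear_pred.
Proof.
split.
  apply/bounded_linearP; split.
    by move=> a x y; rewrite -[LHS]/(0 : Y) -[RHS]/(a *: (0 : Y) + 0) scaler0 addr0.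
  by exists 0 => x; rewrite -[X in `|X|]/(0 : Y) normr0 mul0r.
move=> a f g /bounded_linearP bf /bounded_linearP bg; apply/bounded_linearP.
have [M [M0 Mf]] := bounded_linear_pos bf.
have [N [N0 Ng]] := bounded_linear_pos bg.
split.
  move=> b x y; rewrite -[LHS]/(a *: f (b *: x + y) + g (b *: x + y)).
  rewrite -[RHS]/(b *: (a *: f x + g x) + (a *: f y + g y)).
  by rewrite bf.1 bg.1 !scalerDr !scalerA (mulrC a b) addrACA.
exists (`|a| * M%:C + N%:C) => x; rewrite -[X in `|X|]/(a *: f x + g x) mulrDl.
apply: le_trans (ler_normD _ _) _; rewrite normrZ lerD//.
by rewrite -mulrA ler_wpM2l.
Qed.

HB.instance Definition _ := GRing.isSubmodClosed.Build _ _ bounded_linear_pred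
  bounded_linear_submod_closed.

Record blin := BLin {
  blin_fun :> X -> Y ;
  blinP : blin_fun \in bounded_linear_pred }.

HB.instance Definition _ := [isSub for blin_fun].
HB.instance Definition _ := [Choice of blin by <:].
HB.instance Definition _ := [SubChoice_isSubLmodule of blin by <:].

Lemma blin_linear (f : blin) : linear f.
Proof. by have /bounded_linearP[] := blinP f. Qed.

HB.instance Definition _ (f : blin) :=
  GRing.isLinear.Build C X Y _ f (blin_linear f).

Lemma blin_eqP (f g : blin) : f =1 g <-> f = g.
Proof. by split=> [/funext|->//]; exact: val_inj. Qed.

Lemma blinDE (f g : blin) x : (f + g) x = f x + g x. Proof. by []. Qed.
Lemma blinZE a (f : blin) x : (a *: f) x = a *: f x. Proof. by []. Qed.

(* Norms are R[i]-valued in the library, so the supremum is taken on the real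
   parts and injected back into R[i]. *)
Definition opnorm_set (f : X -> Y) : set R :=
  [set complex.Re `|f x| | x in [set x | `|x| <= 1]].
Definition opnorm (f : blin) : C := (sup (opnorm_set f))%:C.

Lemma Re_normE (Z : normedModType C) (z : Z) : (complex.Re `|z|)%:C = `|z|.
Proof. by rewrite RRe_real ?normr_real. Qed.

Lemma opnorm_has_sup (f : blin) : has_sup (opnorm_set f).
Proof.
split; first by exists (complex.Re `|f 0|), 0 => //=; rewrite normr0 ler01.
have /bounded_linearP/bounded_linear_pos [M [M0 Mf]] := blinP f.
exists M => _ [x /= x1 <-]; rewrite -lecR Re_normE.
by apply: le_trans (Mf x) _; rewrite ler_piMr// ler0c.
Qed.

Lemma opnorm_ub (f : blin) x : `|f x| <= opnorm f * `|x|.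
Proof.
have [->|x0] := eqVneq x 0; first by rewrite linear0 !normr0 mulr0.
have nx : 0 < `|x| by rewrite normr_gt0.
rewrite -ler_pdivrMr//.
have -> : `|f x| / `|x| = `|f (`|x|^-1 *: x)|.
  by rewrite linearZ normrZ normfV normr_id mulrC.
rewrite -Re_normE lecR; apply: sup_upper_bound; first exact: opnorm_has_sup.
exists (`|x|^-1 *: x) => //=.
by rewrite normrZ normfV normr_id mulVf ?gt_eqF.
Qed.

Lemma opnorm_le (f : blin) (M : R) :
  (forall x, `|x| <= 1 -> `|f x| <= M%:C) -> opnorm f <= M%:C.
Proof.
move=> fM; rewrite lecR; apply: ge_sup; first by have [] := opnorm_has_sup f.
by move=> _ [x /= x1 <-]; rewrite -lecR Re_normE fM.
Qed.

Lemma opnorm_ge0 (f : blin) : 0 <= opnorm f.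
Proof.
rewrite ler0c.
apply: (@sup_upper_bound _ _ (opnorm_has_sup f)).
by exists 0; rewrite /= ?linear0 normr0 ?ler01.
Qed.

Lemma opnormD (f g : blin) : opnorm (f + g) <= opnorm f + opnorm g.
Proof.
rewrite -[leRHS](rmorphD (real_complex R)); apply: opnorm_le => x x1.
rewrite blinDE rmorphD; apply: le_trans (ler_normD _ _) _.
by apply: lerD; apply: le_trans (opnorm_ub _ _) _;
  rewrite ler_piMr// opnorm_ge0.
Qed.

Lemma opnormZ a (f : blin) : opnorm (a *: f) = `|a| * opnorm f.
Proof.
have le b (g : blin) : opnorm (b *: g) <= `|b| * opnorm g.
  rewrite -(RRe_real (normr_real b)) -[leRHS](rmorphM (real_complex R)).
  apply: opnorm_le => x x1.
  rewrite blinZE normrZ rmorphM [X in _ <= X * _](RRe_real (normr_real b)) ler_wpM2l//.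
  by apply: le_trans (opnorm_ub _ _) _; rewrite ler_piMr// opnorm_ge0.
apply/eqP; rewrite eq_le le /=.
have [->|a0] := eqVneq a 0; first by rewrite normr0 mul0r opnorm_ge0.
rewrite -ler_pdivlMl ?normr_gt0//.
have {1}-> : f = a^-1 *: (a *: f) by rewrite scalerA mulVf// scale1r.
by rewrite -normfV le.
Qed.

Lemma opnorm0_eq0 (f : blin) : opnorm f = 0 -> f = 0.
Proof.
move=> f0; apply/blin_eqP => x; apply/normr0_eq0/eqP.
by rewrite eq_le normr_ge0 andbT -[leRHS](mul0r `|x|) -f0 opnorm_ub.
Qed.

HB.instance Definition _ :=
  Lmodule_isNormed.Build C blin opnormD opnormZ opnorm0_eq0.

End BoundedLinearMaps.

Arguments bounded_linear_pred {R} X Y.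

Notation "''L' ( X , Y )" := (blin X Y)
  (at level 8, format "''L' ( X ,  Y )") : type_scope.
Notation "''L' ( X )" := (blin X X)
  (at level 8, format "''L' ( X )") : type_scope.

Section OperatorAlgebra.
Variables (R : realType) (X : normedModType R[i]).

Lemma blin_id_subproof : (@id X) \in bounded_linear_pred X X.
Proof. by apply/bounded_linearP; split=> //; exists 1 => x; rewrite mul1r. Qed.
Definition blin_id : 'L(X) := BLin blin_id_subproof.

Lemma blin_comp_subproof (f g : 'L(X)) : (f \o g) \in bounded_linear_pred X X.
Proof.
apply/bounded_linearP; split=> [a x y|]; first by rewrite /= !linearP.
exists (opnorm f * opnorm g) => x /=.
apply: le_trans (opnorm_ub _ _) _; rewrite -mulrA ler_wpM2l ?opnorm_ge0//.
exact: opnorm_ub.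
Qed.
Definition blin_comp (f g : 'L(X)) : 'L(X) := BLin (blin_comp_subproof f g).

Lemma blin_compA : associative blin_comp.
Proof. by move=> f g h; apply/blin_eqP. Qed.
Lemma blin_comp1f : left_id blin_id blin_comp.
Proof. by move=> f; apply/blin_eqP. Qed.
Lemma blin_compf1 : right_id blin_id blin_comp.
Proof. by move=> f; apply/blin_eqP. Qed.
Lemma blin_compDl : left_distributive blin_comp +%R.
Proof. by move=> f g h; apply/blin_eqP. Qed.
Lemma blin_compDr : right_distributive blin_comp +%R.
Proof. by move=> f g h; apply/blin_eqP => x; rewrite /= linearD. Qed.

(* Possibly trivial ring: X = 0 is allowed. *)
HB.instance Definition _ := GRing.Zmodule_isPzRing.Build 'L(X)
  blin_compA blin_comp1f blin_compf1 blin_compDl blin_compDr.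

Lemma blinME (f g : 'L(X)) x : (f * g) x = f (g x). Proof. by []. Qed.
Lemma blin1E x : (1 : 'L(X)) x = x. Proof. by []. Qed.

End OperatorAlgebra.

Section MoorePenrose.
Variables (R : realType) (X : completeNormedModType R[i]).

(* The limit is taken in the operator norm. *)
Definition opexp (A : 'L(X)) : 'L(X) :=
  limn (series (fun n => (n`!%:R : R[i])^-1 *: A ^+ n) : nat -> 'L(X)).

Definition hermitian_op (A : 'L(X)) : Prop :=
  forall t : R, `|opexp ((t%:C * 'i%C) *: A)| = 1.

Definition is_MoorePenrose (T S : 'L(X)) : Prop :=
  [/\ T = T * S * T, S = S * T * S, hermitian_op (T * S) & hermitian_op (S * T)].

Definition EP (T : 'L(X)) : Prop :=
  exists S : 'L(X), is_MoorePenrose T S /\ T * S = S * T.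

End MoorePenrose.

Section DirectSum.
Variables (R : realType) (X1 X2 : normedModType R[i]).

(* An alias of the product, whose library norm is the max norm. *)
Definition dsum : Type := (X1 * X2)%type.

HB.instance Definition _ := GRing.Lmodule.copy dsum (X1 * X2)%type.

Definition dsum_norm (x : dsum) : R[i] := `|x.1| + `|x.2|.

Lemma dsum_normD x y : dsum_norm (x + y) <= dsum_norm x + dsum_norm y.
Proof. by rewrite /dsum_norm addrACA lerD// ler_normD. Qed.

Lemma dsum_normZ a x : dsum_norm (a *: x) = `|a| * dsum_norm x.
Proof. by rewrite /dsum_norm !normrZ mulrDr. Qed.

Lemma dsum_norm0_eq0 x : dsum_norm x = 0 -> x = 0.
Proof.
case: x => x y /eqP; rewrite /dsum_norm paddr_eq0// !normr_eq0 /=.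
by move=> /andP[/eqP-> /eqP->].
Qed.

HB.instance Definition _ :=
  Lmodule_isNormed.Build R[i] dsum dsum_normD dsum_normZ dsum_norm0_eq0.

End DirectSum.

Notation "X1 '(+)_1' X2" := (dsum X1 X2) (at level 50, format "X1  (+)_1  X2") : type_scope.

Section SumZero.
Variables (R : realType) (X1 X2 : normedModType R[i]).

Definition opsum0_fun (T1 : 'L(X1)) (x : X1 (+)_1 X2) : X1 (+)_1 X2 :=
  (T1 x.1, 0).

Lemma opsum0_subproof (T1 : 'L(X1)) :
  opsum0_fun T1 \in bounded_linear_pred (X1 (+)_1 X2) (X1 (+)_1 X2).
Proof.
apply/bounded_linearP; split=> [a x y|].
  rewrite -[RHS]/(a *: T1 x.1 + T1 y.1, a *: (0 : X2) + 0) scaler0 addr0.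
  by rewrite /opsum0_fun linearP.
exists (opnorm T1) => x; rewrite [leLHS]/(dsum_norm _)/= normr0 addr0.
apply: le_trans (opnorm_ub _ _) _; rewrite ler_wpM2l ?opnorm_ge0//.
by rewrite [leRHS]/(dsum_norm _) lerDl.
Qed.

Definition opsum0 (T1 : 'L(X1)) : 'L(X1 (+)_1 X2) := BLin (opsum0_subproof T1).

End SumZero.

Arguments opsum0 {R X1} X2 T1.

(* Main.v *)
(* If T is EP, then P = T T^dag = T^dag T is a hermitian idempotent commuting with
   T, and T is invertible on R(P) and vanishes on N(P); take X1 = R(P) and
   X2 = N(P), with S the sum map and U x = (P x, x - P x).
   Conversely, surjectivity of U, injectivity of S and bijectivity of T1 give
   R(T) = R(P) and N(T) = N(P), i.e. P T = T = T P and A = T + (1 - P) is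
   bijective. By the open mapping theorem A has a bounded inverse B, and B P is
   the Moore-Penrose inverse of T, with T (B P) = P = (B P) T. *)
From HB Require Import structures.
Require Import Defs.
From mathcomp Require Import all_boot all_order all_algebra.
From mathcomp Require Import complex.
From mathcomp Require Import all_classical all_reals all_analysis.
From mathcomp Require Import ring.

Set Implicit Arguments.
Unset Strict Implicit.
Unset Printing Implicit Defensive.

Import Order.TTheory GRing.Theory Num.Theory.
Import numFieldNormedType.Exports.

Local Open Scope classical_set_scope.
Local Open Scope complex_scope.
Local Open Scope ring_scope.

(** * Continuity of bounded linear maps *)

Lemma lipschitz_linear_continuous (K : numFieldType) (V W : normedModType K)
    (f : {linear V -> W}) (M : K) :
  0 <= M -> (forall x, `|f x| <= M * `|x|) -> continuous f.
Proof.
move=> M0 fM; apply/linear_bounded_continuous/ex_bound; exists M.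
apply/nbhs_norm0P; exists 1 => //= x x1.
by apply: le_trans (fM x) _; rewrite ler_piMr// ltW.
Qed.

Lemma blin_continuous (R : realType) (X Y : normedModType R[i]) (f : 'L(X, Y)) :
  continuous f.
Proof.
apply: (@lipschitz_linear_continuous _ _ _ f (opnorm f)).
  exact: opnorm_ge0.
exact: opnorm_ub.
Qed.

(** * The open mapping theorem over real scalars *)

Section OpenMapping.
Variables (K : realType) (V W : completeNormedModType K) (A : {linear V -> W}).
Hypothesis surjA : forall y, exists x, A x = y.

(** By Baire, the closure of the image of some ball contains a ball around a point [y0]. Subtracting
    approximate preimages of [y0] from those of [y0 + z] handles all small [z], and scaling handles
    every [y]. *)
Lemma surjective_almost_open : exists2 M : K, 0 <= M &
  forall y, exists2 x, `|x| <= M * `|y| & `|y - A x| <= 2^-1 * `|y|.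
Proof.
pose F n : set W := ~` closure (A @` ball (0 : V) n.+1%:R).
(* If every open set [F n] were dense, some [y] would lie in all of them; but [y = A x] lies in the
   image of the ball of radius [truncn |x| + 1]. *)
have [n /existsNP[G /not_implyP[G0 /not_implyP[openG FG0]]]] :
    exists n, ~ dense (F n).
  apply/existsNP => denseF.
  have [y [_ Fy]] : setT `&` \bigcap_n F n !=set0.
    apply: Baire; [|by exists 0|exact: openT].
    by split; [apply: closed_openC; exact: closed_closure|exact: denseF].
  have [x Axy] := surjA y.
  apply: (Fy (Num.truncn `|x|)) => //; apply: subset_closure; exists x => //.
  by rewrite -ball_normE /= sub0r normrN truncnS_gt.
have clG y : G y -> closure (A @` ball (0 : V) n.+1%:R) y.
  by move=> Gy; apply: contrapT => Fy; apply: FG0; exists y.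
have [y0 Gy0] := G0.
have [r /= r0 rG] : nbhs_ball y0 G.
  by apply/nbhs_ballP; exact: open_nbhs_nbhs.
have near_img e y : 0 < e -> G y ->
    exists2 x, `|x| < n.+1%:R & `|y - A x| < e.
  move=> e0 /clG /(_ _ (nbhsx_ballx y e e0)) [_ [[x xn <-]]].
  rewrite -!ball_normE /= => yx; exists x => //.
  by move: xn; rewrite -ball_normE /= sub0r normrN.
have r20 : 0 < r / 2 by rewrite divr_gt0.
have small z : `|z| < r ->
    exists2 x, `|x| <= 2 * n.+1%:R & `|z - A x| <= r / 4.
  (* Two errors of [r / 8] add up to [r / 4], which is half the norm [r / 2] to which [y] is
     rescaled below. *)
  move=> zr; have r80 : 0 < r / 8 by rewrite divr_gt0.
  have [x1 x1n yx1] : exists2 x, `|x| < n.+1%:R & `|y0 + z - A x| < r / 8.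
    apply: near_img => //; apply: rG.
    by rewrite -ball_normE /= opprD addNKr normrN.
  have [x2 x2n yx2] := near_img _ _ r80 Gy0.
  exists (x1 - x2).
    by rewrite mulr2n mulrDl mul1r (le_trans (ler_normB _ _))// lerD// ltW.
  have -> : z - A (x1 - x2) = (y0 + z - A x1) - (y0 - A x2).
    by rewrite linearB !opprB addrCA -(addrA y0) [RHS]addrC [RHS]addrA subrK.
  rewrite (le_trans (ler_normB _ _))//.
  have -> : r / 4 = r / 8 + r / 8 by field.
  by rewrite lerD// ltW.
(* This is the bound [2 * n.+1] divided by the scaling factor [c = r / (2 |y|)], with [|y|] split
   off. *)
exists (4 * n.+1%:R / r).
  by rewrite divr_ge0 ?mulr_ge0 ?ler0n// ltW.
move=> y; have [->|y_neq0] := eqVneq y 0.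
  by exists 0; rewrite ?(linear0 A, subr0) !normr0 mulr0.
have ny : 0 < `|y| by rewrite normr_gt0.
pose c := r / 2 / `|y|.
have c0 : 0 < c by rewrite divr_gt0.
have cy : c * `|y| = r / 2 by rewrite divfK ?gt_eqF.
have [x xn xr] : exists2 x, `|x| <= 2 * n.+1%:R & `|c *: y - A x| <= r / 4.
  by apply: small; rewrite normrZ gtr0_norm// cy gtr_pMr// invf_lt1// ltr1n.
exists (c^-1 *: x).
  rewrite normrZ gtr0_norm ?invr_gt0// ler_pdivrMl// mulrCA cy.
  suff -> : 4 * n.+1%:R / r * (r / 2) = 2 * n.+1%:R by [].
  by field; rewrite gt_eqF.
have -> : y - A (c^-1 *: x) = c^-1 *: (c *: y - A x).
  by rewrite linearZ scalerBr scalerA mulVf ?gt_eqF// scale1r.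
rewrite normrZ gtr0_norm ?invr_gt0// ler_pdivrMl// mulrCA cy.
by suff <- : r / 4 = 2^-1 * (r / 2) by []; field.
Qed.

(* Successive approximation: each residual is at most half of the previous one,
   and the corrections form an absolutely convergent series. *)
Lemma surjective_bounded_preimage : continuous A -> exists2 M : K, 0 <= M &
  forall y, exists2 x, A x = y & `|x| <= M * `|y|.
Proof.
move=> contA; have [M M0 approx] := surjective_almost_open.
have /choice[g gP] : forall y, exists x,
    `|x| <= M * `|y| /\ `|y - A x| <= 2^-1 * `|y|.
  by move=> y; have [x] := approx y; exists x.
(* The factor 2 is the sum of the geometric series of ratio [2^-1] that dominates the
   corrections. *)
exists (M * 2) => [|y]; first by rewrite mulr_ge0.
(* [r n] is the residual after [n] corrections, and [u n] is the next correction. *)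
pose r n := iter n (fun z => z - A (g z)) y.
pose u : V^nat := fun n => g (r n).
have half_lt1 : `|2^-1 : K| < 1 by rewrite gtr0_norm ?invr_gt0// invf_lt1 ?ltr1n.
have rn n : `|r n| <= geometric `|y| 2^-1 n.
  elim: n => [|n IHn]; first by rewrite /= expr0 mulr1.
  apply: le_trans (gP (r n)).2 _.
  by rewrite /= exprS mulrCA ler_pM2l ?invr_gt0.
have un n : `|u n| <= geometric (M * `|y|) 2^-1 n.
  by apply: le_trans (gP (r n)).1 _; rewrite /= -mulrA ler_wpM2l// rn.
have cvg_normu : cvgn [normed series u].
  apply: (@series_le_cvg _ _ (geometric (M * `|y|) 2^-1)) => //.
  - by move=> n; rewrite /= normr_ge0.
  - by move=> n; apply: geometric_ge0; rewrite ?mulr_ge0 ?invr_ge0.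
  - exact: is_cvg_geometric_series.
(* Telescoping: [series u n] sums the first [n] corrections, and is empty for [n = 0], where
   [r 0 = y]. *)
have Au n : A (series u n) = y - r n.
  elim: n => [|n IHn]; first by rewrite /series /= big_geq// linear0 subrr.
  by rewrite seriesSr linearD IHn /= opprB [RHS]addrA [LHS]addrAC.
exists (limn (series u)).
  have r0 : r @ \oo --> 0.
    apply: norm_cvg0; apply: (@squeeze_cvgr _ _ _ _ (cst 0) (geometric `|y| 2^-1)).
    - by apply: nearW => n; rewrite normr_ge0 rn.
    - exact: cvg_cst.
    - exact: cvg_geometric.
  apply: (@cvg_unique _ (@norm_hausdorff _ W) ((A \o series u) @ \oo)).
    by apply: continuous_cvg; [exact: contA|exact: normed_cvg].
  rewrite [A \o _](_ : _ = fun n => y - r n); last exact/funext.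
  have := cvgB (cvg_cst y) r0; rewrite subr0; exact.
apply: le_trans (lim_series_norm cvg_normu) _.
have -> : M * 2 * `|y| = limn (series (geometric (M * `|y|) 2^-1)).
  rewrite (cvg_lim _ (@cvg_geometric_series _ _ _ half_lt1))//.
  by field.
by apply: lim_series_le => //; exact: is_cvg_geometric_series.
Qed.

End OpenMapping.

(** * A complex Banach space regarded as a real one *)

Section RealScalars.
Variables (R : realType) (V : completeNormedModType R[i]).

(* The library's Baire theorem is restricted to real scalars. *)
Definition realify : Type := V.

HB.instance Definition _ := GRing.Zmodule.copy realify V.

Definition realify_scale (a : R) (x : realify) : realify := a%:C *: (x : V).

Lemma realify_scaleA a b x :
  realify_scale a (realify_scale b x) = realify_scale (a * b) x.
Proof. by rewrite /realify_scale scalerA rmorphM. Qed.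

Lemma realify_scale1 : left_id 1 realify_scale.
Proof. by move=> x; rewrite /realify_scale scale1r. Qed.

Lemma realify_scaleDr : right_distributive realify_scale +%R.
Proof. by move=> a x y; rewrite /realify_scale scalerDr. Qed.

Lemma realify_scaleDl x : {morph realify_scale^~ x : a b / a + b}.
Proof. by move=> a b; rewrite /realify_scale rmorphD scalerDl. Qed.

HB.instance Definition _ := GRing.Zmodule_isLmodule.Build R realify
  realify_scaleA realify_scale1 realify_scaleDr realify_scaleDl.

Definition realify_norm (x : realify) : R := complex.Re `|(x : V)|.

Lemma realify_normE (x : realify) : (realify_norm x)%:C = `|(x : V)|.
Proof. exact: Re_normE. Qed.

Lemma realify_normD x y :
  realify_norm (x + y) <= realify_norm x + realify_norm y.
Proof.
by have := @ler_normD _ V x y; rewrite -!realify_normE -rmorphD lecR.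
Qed.

Lemma realify_normZ a x : realify_norm (a *: x) = `|a| * realify_norm x.
Proof.
apply: (@complexI R); rewrite rmorphM !realify_normE.
rewrite -[a *: x]/(a%:C *: (x : V)) normrZ normc_def /= expr0n /= addr0 sqrtr_sqr.
by congr (_ * _); rewrite -realify_normE.
Qed.

Lemma realify_norm0_eq0 x : realify_norm x = 0 -> x = 0.
Proof. by move=> x0; apply: (@normr0_eq0 _ V); rewrite -realify_normE x0. Qed.

HB.instance Definition _ := Lmodule_isNormed.Build R realify
  realify_normD realify_normZ realify_norm0_eq0.

Lemma realify_ball (x : V) (e : R) : ball (x : realify) e = ball x e%:C.
Proof.
rewrite -!ball_normE; apply/seteqP; split=> y /=;
  by rewrite -ltcR realify_normE.
Qed.

Lemma realify_cauchy_cvg (F : set_system realify) :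
  ProperFilter F -> cauchy F -> cvg F.
Proof.
move=> FF /cauchyP Fc.
have /cauchy_cvg/cvg_ex[/= l Fl] : cauchy (F : set_system V).
  apply: cauchy_exP => e e0.
  (* A positive element of [R[i]] is real, so both structures have the same balls. *)
  have eE : e = (complex.Re e)%:C by rewrite RRe_real// gtr0_real.
  have [|x Fx] := Fc (complex.Re e); first by rewrite -ltcR -eE.
  by exists x; rewrite eE -realify_ball.
apply/cvg_ex; exists l; apply/cvg_ballP => e e0.
by move/cvg_ballP : Fl => /(_ e%:C); rewrite ltcR -realify_ball; exact.
Qed.

HB.instance Definition _ := Uniform_isComplete.Build realify realify_cauchy_cvg.

End RealScalars.

(** * The fixed points of a bounded operator as a Banach space *)

Section FixedSpace.
Variables (R : realType) (X : completeNormedModType R[i]) (P : 'L(X)).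

(** For idempotent [P] this is [R(P)], and for [1 - P] it is [N(P)]; an equation between continuous
    maps passes to limits at once. *)
Definition fixed_pred : {pred X} := fun x => P x == x.

Lemma fixed_submod_closed : submod_closed fixed_pred.
Proof.
split=> [|a x y]; first by rewrite unfold_in linear0.
by rewrite !unfold_in => /eqP Px /eqP Py; rewrite linearP /= Px Py.
Qed.

HB.instance Definition _ := GRing.isSubmodClosed.Build _ _ fixed_pred
  fixed_submod_closed.

Record fixed_space := FixedSpace {
  fixed_val : X ;
  fixed_valP : fixed_val \in fixed_pred }.

HB.instance Definition _ := [isSub for fixed_val].
HB.instance Definition _ := [Choice of fixed_space by <:].
HB.instance Definition _ := [SubChoice_isSubLmodule of fixed_space by <:].

Lemma fixedE (x : fixed_space) : P (val x) = val x.
Proof. exact: eqP (fixed_valP x). Qed.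

Definition fixed_norm (x : fixed_space) : R[i] := `|val x|.

Lemma fixed_normD x y : fixed_norm (x + y) <= fixed_norm x + fixed_norm y.
Proof. by rewrite /fixed_norm raddfD ler_normD. Qed.

Lemma fixed_normZ a x : fixed_norm (a *: x) = `|a| * fixed_norm x.
Proof. by rewrite /fixed_norm linearZ normrZ. Qed.

Lemma fixed_norm0_eq0 x : fixed_norm x = 0 -> x = 0.
Proof. by move=> /normr0_eq0 x0; apply: val_inj; rewrite x0 raddf0. Qed.

HB.instance Definition _ := Lmodule_isNormed.Build R[i] fixed_space
  fixed_normD fixed_normZ fixed_norm0_eq0.

(** The limit exists in [X], and continuity of [P] makes it a fixed point. *)
Lemma fixed_cauchy_cvg (F : set_system fixed_space) :
  ProperFilter F -> cauchy F -> cvg F.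
Proof.
move=> FF /cauchyP Fc.
have ballE (x : fixed_space) e : ball x e = fixed_val @^-1` ball (val x) e.
  rewrite -!ball_normE; apply/seteqP; split=> y /=;
    by rewrite -[`|_ - _|]/(`|val (x - y)|) raddfB.
have /cauchy_cvg/cvg_ex[/= l Fl] : cauchy (fixed_val @ F).
  apply: cauchy_exP => e e0; have [x Fx] := Fc _ e0.
  by exists (val x); rewrite ballE in Fx.
have Pl : l \in fixed_pred.
  rewrite unfold_in; apply/eqP.
  apply: (@cvg_unique _ (@norm_hausdorff _ X) (fixed_val @ F)) => //.
  have : (P \o fixed_val) @ F --> P l.
    by apply: continuous_cvg Fl; exact: blin_continuous.
  by rewrite (_ : P \o fixed_val = fixed_val)//; apply/funext => x; exact: fixedE.
apply/cvg_ex; exists (FixedSpace Pl); apply/cvg_ballP => e e0.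
by move/cvg_ballP : Fl => /(_ e e0); rewrite ballE.
Qed.

HB.instance Definition _ := Uniform_isComplete.Build fixed_space fixed_cauchy_cvg.

End FixedSpace.

(** * The bounded inverse theorem over complex scalars *)

Section BoundedInverse.
Variables (R : realType) (X Y : completeNormedModType R[i]).

Definition realify_map (f : 'L(X, Y)) : realify X -> realify Y := f.

Lemma realify_map_linear (f : 'L(X, Y)) : linear (realify_map f).
Proof. by move=> a x y; exact: (@linearP _ _ _ _ f a%:C). Qed.

HB.instance Definition _ (f : 'L(X, Y)) :=
  GRing.isLinear.Build R (realify X) (realify Y) _ (realify_map f)
    (realify_map_linear f).

Lemma realify_map_continuous (f : 'L(X, Y)) : continuous (realify_map f).
Proof.
have /bounded_linearP/bounded_linear_pos[M [M0 fM]] := blinP f.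
apply: (@lipschitz_linear_continuous _ _ _ (realify_map f) M) => // x.
by have := fM x; rewrite -!realify_normE -rmorphM lecR.
Qed.

(** The norm bound comes from the open mapping theorem on the underlying real spaces; complex
    linearity of the inverse follows from injectivity of [f]. *)
Lemma bijective_bounded_inverse (f : 'L(X, Y)) :
  bijective f -> exists g : 'L(Y, X), cancel f g /\ cancel g f.
Proof.
move=> [g fK gK].
have [M M0 gM] : exists2 M : R, 0 <= M &
    forall y : realify Y, exists2 x, realify_map f x = y & `|x| <= M * `|y|.
  apply: surjective_bounded_preimage; last exact: realify_map_continuous.
  by move=> y; exists (g y); exact: gK.
have bg : g \in bounded_linear_pred Y X.
  apply/bounded_linearP; split=> [a x y|].
    by apply: (can_inj fK); rewrite linearP /= !gK.
  exists M%:C => y; have [x <-] := gM y.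
  rewrite -lecR rmorphM => xM.
  by rewrite fK -!realify_normE.
by exists (BLin bg).
Qed.

End BoundedInverse.

(** * Splitting [X] along an idempotent *)

Section Decomposition.
Variables (R : realType) (X : completeNormedModType R[i]).

Lemma fixed_restrict_subproof (P T : 'L(X)) (cPT : P * T = T * P)
  (x : fixed_space P) : T (val x) \in fixed_pred P.
Proof. by rewrite unfold_in -blinME cPT blinME fixedE. Qed.

Definition fixed_restrict_fun (P T : 'L(X)) (cPT : P * T = T * P)
  (x : fixed_space P) : fixed_space P :=
  FixedSpace (fixed_restrict_subproof cPT x).

Lemma fixed_restrict_bounded (P T : 'L(X)) (cPT : P * T = T * P) :
  fixed_restrict_fun cPT \in bounded_linear_pred _ _.
Proof.
apply/bounded_linearP; split=> [a x y|].
  by apply: val_inj; rewrite [RHS]linearP [val _]linearP.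
by exists (opnorm T) => x; exact: (opnorm_ub T (val x)).
Qed.

Definition fixed_restrict P T cPT : 'L(fixed_space P) :=
  BLin (@fixed_restrict_bounded P T cPT).

Lemma idempotent_fixed (P : 'L(X)) (PP : P * P = P) x : P x \in fixed_pred P.
Proof. by rewrite unfold_in -blinME PP. Qed.

Variables (P : 'L(X)) (PP : P * P = P).

Lemma idempotentC : (1 - P) * (1 - P) = 1 - P.
Proof. by rewrite mulrBr mulr1 mulrBl mul1r PP subrr subr0. Qed.

Definition fixed_sum_fun (x : fixed_space P (+)_1 fixed_space (1 - P)) : X :=
  val x.1 + val x.2.

Lemma fixed_sum_bounded : fixed_sum_fun \in bounded_linear_pred _ _.
Proof.
apply/bounded_linearP; split=> [a x y|].
  by rewrite /fixed_sum_fun !linearP /= scalerDr addrACA.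
by exists 1 => x; rewrite mul1r; exact: ler_normD.
Qed.

Definition fixed_sum : 'L(fixed_space P (+)_1 fixed_space (1 - P), X) :=
  BLin fixed_sum_bounded.

Definition fixed_split_fun (x : X) : fixed_space P (+)_1 fixed_space (1 - P) :=
  (FixedSpace (idempotent_fixed PP x),
   FixedSpace (idempotent_fixed idempotentC x)).

Lemma fixed_split_bounded : fixed_split_fun \in bounded_linear_pred _ _.
Proof.
apply/bounded_linearP; split=> [a x y|].
  by congr pair; apply: val_inj; rewrite [RHS]linearP; exact: linearP.
exists (opnorm P + opnorm (1 - P)) => x; rewrite mulrDl.
by apply: lerD; exact: opnorm_ub.
Qed.

Definition fixed_split : 'L(X, fixed_space P (+)_1 fixed_space (1 - P)) :=
  BLin fixed_split_bounded.

Lemma fixed_sumE x : fixed_sum x = val x.1 + val x.2. Proof. by []. Qed.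

Lemma fixed_split1E x : val (fixed_split x).1 = P x. Proof. by []. Qed.

Lemma fixed_split2E x : val (fixed_split x).2 = x - P x. Proof. by []. Qed.

Lemma fixedC_eq0 (y : fixed_space (1 - P)) : P (val y) = 0.
Proof.
have : val y - P (val y) = val y by exact: (fixedE y).
by move/eqP; rewrite -subr_eq0 addrAC subrr sub0r oppr_eq0 => /eqP.
Qed.

(** This single identity yields both the injectivity of [S] and the surjectivity of [U] in the
    factorization. *)
Lemma fixed_sumK : cancel fixed_sum fixed_split.
Proof.
move=> [x y]; have Pxy : P (fixed_sum (x, y)) = val x.
  by rewrite fixed_sumE linearD /= fixedE fixedC_eq0 addr0.
by congr pair; apply: val_inj;
  rewrite ?fixed_split1E ?fixed_split2E Pxy// fixed_sumE addrC addKr.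
Qed.

End Decomposition.

(** * EP operators and their factorizations *)

Theorem theorem5p4 (R : realType) (X : completeNormedModType R[i]) (T : 'L(X)) :
  EP T <->
  exists (X1 X2 : completeNormedModType R[i])
    (T1 : 'L(X1)) (S : 'L(X1 (+)_1 X2, X)) (U : 'L(X, X1 (+)_1 X2)) (P : 'L(X)),
    [/\ bijective T1, injective S & forall y, exists x, U x = y] /\
    (hermitian_op P /\ P * P = P) /\
    [/\ (T : X -> X) = S \o opsum0 X2 T1 \o U,
        range P = S @` [set x : X1 (+)_1 X2 | x.2 = 0] &
        P @^-1` [set 0] = U @^-1` [set x : X1 (+)_1 X2 | x.1 = 0] ].
Proof.
split=> [[Q [[TQT QTQ hermTQ hermQT] TQ]]|].
  pose P := T * Q.
  have PP : P * P = P by rewrite /P mulrA -TQT.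
  have PT : P * T = T * P by rewrite /P TQ mulrA -TQ.
  have PT' : P * T = T by rewrite /P -TQT.
  have PQ : P * Q = Q * P by rewrite /P {1}TQ mulrA.
  (* Since [T Q = Q T = P] acts as the identity on the fixed points of [P], the restriction of [Q]
     inverts that of [T]. *)
  have cancelTQ (x : fixed_space P) : T (Q (val x)) = val x by rewrite -blinME fixedE.
  have cancelQT (x : fixed_space P) : Q (T (val x)) = val x.
    by rewrite -blinME -TQ fixedE.
  exists (fixed_space P), (fixed_space (1 - P)), (fixed_restrict PT),
    (fixed_sum P), (fixed_split PP), P.
  split; [split|split; [by []|split]].
  - by exists (fixed_restrict PQ) => x; apply: val_inj;
      [exact: cancelQT|exact: cancelTQ].
  - exact: can_inj (fixed_sumK PP).
  - by move=> y; exists (fixed_sum P y); exact: fixed_sumK.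
  - apply/funext => x.
    rewrite -[RHS]/(T (P x) + val (0 : fixed_space (1 - P))) raddf0 addr0.
    by rewrite -blinME -PT PT'.
  - apply/seteqP; split=> [_ [x _ <-]|_ [x x2 <-]].
      exists ((fixed_split PP x).1, 0) => //.
      by rewrite fixed_sumE [X in _ + X]raddf0 addr0.
    by exists (fixed_sum P x) => //; rewrite fixed_sumE x2 [X in _ + X]raddf0 addr0 fixedE.
  - apply/seteqP; split=> x /=.
      by move=> Px; apply: val_inj; rewrite raddf0.
    by move=> /(congr1 val); rewrite raddf0.
move=> [X1 [X2 [T1 [S [U [P [[bijT1 injS surjU] [[hermP PP] [TE rangeP kerP]]]]]]]]].
have TxE x : T x = S (T1 (U x).1, 0) by rewrite TE.
have [T1' T1K T1'K] := bijT1.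
have PPE x : P (P x) = P x by exact: (congr1 (fun f : 'L(X) => f x) PP).
have PT : P * T = T.
  apply/blin_eqP => x; rewrite blinME.
  have : range P (T x) by rewrite rangeP TxE; exists (T1 (U x).1, 0).
  by case=> z _ <-; exact: PPE.
(* Injectivity of [S] and of [T1] reduces [T x = 0] to [(U x).1 = 0], which [kerP] identifies with
   [P x = 0]. *)
have kerT x : T x = 0 <-> P x = 0.
  have -> : (P x = 0) = ((U x).1 = 0) by exact: (congr1 (@^~ x) kerP).
  rewrite TxE; split=> [|->]; last by rewrite linear0; exact: linear0.
  rewrite -[X in _ = X](linear0 S) => /injS/(congr1 fst) /= T10.
  by apply: (can_inj T1K); rewrite T10 linear0.
have TP : T * P = T.
  (* [x - P x] lies in [N(P)], hence in [N(T)]. *)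
  apply/blin_eqP => x; apply/esym/eqP; rewrite -subr_eq0 blinME -linearB.
  by apply/eqP/kerT; rewrite linearB /= PPE subrr.
(* A is T on range P plus the identity on ker P, so bounded inversion is only
   needed on X itself, not on the closed subspace range P. *)
pose A : 'L(X) := T + (1 - P).
have AE x : A x = T x + (x - P x) by [].
have PA : P * A = T by rewrite mulrDr mulrBr mulr1 PP subrr addr0.
have AP : A * P = T by rewrite mulrDl mulrBl mul1r PP subrr addr0.
have injA : injective A.
  apply: raddf_inj => x Ax0.
  have Tx : T x = 0.
    have <- : P (A x) = T x by exact: (congr1 (fun f : 'L(X) => f x) PA).
    by rewrite [A x]Ax0 linear0.
  by move: Ax0; rewrite [LHS]AE Tx (kerT x).1// subr0 add0r.
have surjA y : exists x, A x = y.
  have [/= [x1 x2] /= x20 Sx] : (S @` [set x : X1 (+)_1 X2 | x.2 = 0]) (P y).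
    by rewrite -rangeP; exists y.
  (* With [P y = S (x1, 0)], this choice of [u] gives [T u = P y]. *)
  have [u Uu] := surjU (T1' x1, 0).
  have Tu : T u = P y by rewrite TxE Uu /= T1'K -Sx -x20.
  (* [A] sends [P u] to [T u = P y] and fixes [y - P y], which lies in [N(P)]. *)
  exists (P u + (y - P y)).
  have Pz : P (y - P y) = 0 by rewrite linearB /= PPE subrr.
  have TPu : T (P u) = P y.
    by rewrite -Tu; exact: (congr1 (fun f : 'L(X) => f u) TP).
  rewrite [LHS]AE (linearD T) (linearD P) /= Pz (kerT (y - P y)).2// PPE TPu !addr0.
  by rewrite (addrC (P u)) addrK addrC subrK.
have [B [AK BK]] : exists B : 'L(X), cancel A B /\ cancel B A.
  apply: bijective_bounded_inverse; have [g gK] := choice surjA.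
  by exists g => // x; apply: injA.
have BA : B * A = 1 by apply/blin_eqP.
have AB : A * B = 1 by apply/blin_eqP.
have TB : T * B = P by rewrite -PA -mulrA AB mulr1.
have BT : B * T = P by rewrite -AP mulrA BA mul1r.
have PB : P * B = B * P by rewrite -{1}BT -mulrA TB.
(* Both products with [T] equal [P], so the two hermitian conditions reduce to [hermP]. *)
exists (B * P); split; last by rewrite mulrA TB PP -mulrA PT BT.
split.
- by rewrite mulrA TB PP PT.
- by rewrite -(mulrA B) PT BT mulrA PB -mulrA PP.
- by rewrite mulrA TB PP.
- by rewrite -mulrA PT BT.
Qed.
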